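(* Let $X$ be a metrizable topological space such that $d(X)<\mathfrak{s}$. Then every sequence $(K_n)_{n\in\omega}$ of subsets of $X$ has a convergent subsequence.
   Context: $d(X)$ denotes the density of $X$, the least cardinality of a dense subset of $X$. A family $\mathcal{S}\subseteq[\omega]^\omega$ of infinite subsets of $\omega$ is a splitting family if for every $A\in[\omega]^\omega$ there is $S\in\mathcal{S}$ such that $A\cap S$ and $A\setminus S$ are both infinite; the splitting number $\mathfrak{s}$ is the smallest cardinality of a splitting family. Convergence is in the sense of Kuratowski: for a sequence $(K_n)_{n\in A}$ of subsets of $X$ indexed by an infinite set $A\subseteq\omega$, $\mathrm{Li}\,(K_n)_{n\in A}$ is the set of all $x\in X$ such that for every neighborhood $U$ of $x$, $U\cap K_n\neq\emptyset$ for all but finitely many $n\in A$; and $\mathrm{Ls}\,(K_n)_{n\in A}$ is the set of all $x\in X$ such that for every neighborhood $U$ of $x$, $U\cap K_n\neq\emptyset$ for infinitely many $n\in A$. The sequence converges if $\mathrm{Li}\,(K_n)_{n\in A}=\mathrm{Ls}\,(K_n)_{n\in A}$ (this common set may be empty). A subsequence of $(K_n)_{n\in\omega}$ is a sequence $(K_n)_{n\in A}$ with $A\subseteq\omega$ infinite. *)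

(* Defs.v *)
From HB Require Import structures.
From mathcomp Require Import all_boot all_order all_algebra.
From mathcomp Require Import boolp classical_sets functions cardinality reals.
From mathcomp Require Import topology.

Set Implicit Arguments.
Unset Strict Implicit.
Unset Printing Implicit Defensive.

Import Order.TTheory GRing.Theory Num.Theory.
Local Open Scope classical_set_scope.
Local Open Scope card_scope.
Local Open Scope ring_scope.

(** Cardinals are represented by sets attaining them: the least cardinality of
    a member of [F] is represented by a chosen member of [F] which injects into
    every other member.  By [min_cardP] one exists as soon as [F] is nonempty,
    so that the default value [set0] is then irrelevant. *)
Definition min_card (T : Type) (F : set (set T)) : set T :=
  xget set0 [set A | F A /\ forall B, F B -> A #<= B].

Definition card_lt (T U : Type) (A : set T) (B : set U) : Prop :=
  A #<= B /\ ~ (B #<= A).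

(* A maximal set of choice functions on F with pairwise disjoint graphs must
   exhaust some member of F. *)
Lemma min_cardP (T : Type) (F : set (set T)) : F !=set0 ->
  F (min_card F) /\ forall B, F B -> min_card F #<= B.
Proof.
move=> [A0 FA0]; apply: (xgetPex set0
  (P := [set A | F A /\ forall B, F B -> A #<= B])).
pose I := {A : set T | F A}.
pose good (G : set (I -> T)) := forall g, G g ->
  (forall i : I, sval i (g i)) /\
  (forall h, G h -> forall i, g i = h i -> g = h).
have [C Cgood Ctot|G [Ggood Gmax]] := @Zorn_bigcup _ good.
  move=> g [G CG Gg]; split=> [i|h [H CH Hh] i gh].
    by have [/(_ i)] := Cgood _ CG _ Gg.
  have [GH|HG] := Ctot _ _ CG CH.
    by have [_ /(_ h Hh i gh)] := Cgood _ CH _ (GH _ Gg).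
  by have [_ /(_ h (HG _ Hh) i gh)] := Cgood _ CG _ Gg.
have [[i Gi]|noi] := pselect
    (exists i : I, forall a, sval i a -> exists2 g, G g & g i = a).
  exists (sval i); split=> [|B FB]; first exact: (svalP i).
  pose j : I := exist _ B FB.
  apply: (@card_le_trans _ _ _ G).
    apply: card_le_trans (card_image_le (fun g : I -> T => g i) G).
    by apply: subset_card_le => a /Gi[g Gg <-]; exists g.
  have Ginj : {in G &, injective (fun g : I -> T => g j)}.
    by move=> g h /set_mem Gg /set_mem Gh; apply: (Ggood g Gg).2.
  have := inj_card_eq Ginj; rewrite card_eq_sym card_eq_le => /andP[+ _].
  move=> /card_le_trans; apply; apply: subset_card_le => _ [g Gg <-].
  exact: ((Ggood g Gg).1 j).
have /choice[g gP] : forall i : I, exists a,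
    sval i a /\ forall h, G h -> h i <> a.
  move=> i; apply: contrapT => na; apply: noi; exists i => a ia.
  apply: contrapT => nG; apply: na; exists a; split=> // h Gh hia.
  by apply: nG; exists h.
have nGg : ~ G g by move=> Gg; exact: (gP (exist _ A0 FA0)).2 Gg erefl.
exfalso; apply: (Gmax (G `|` [set g])).
  split=> [h|sub]; first by left.
  by apply: nGg; apply: sub; right.
move=> h [Gh|->]; split=> [i|k].
- exact: ((Ggood h Gh).1 i).
- move=> [Gk|->] i hk; first exact: ((Ggood h Gh).2 k Gk i hk).
  by case: ((gP i).2 _ Gh).
- exact: (gP i).1.
- by move=> [Gk|->] i // hk; case: ((gP i).2 _ Gk).
Qed.

Definition density (X : topologicalType) : set X := min_card (@dense X).
Arguments density X : clear implicits.

Lemma densityP (X : topologicalType) :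
  dense (density X) /\ forall D : set X, dense D -> density X #<= D.
Proof. by apply: min_cardP; exists setT => O O0 _; rewrite setIT. Qed.

Definition splitting_family (S : set (set nat)) : Prop :=
  (forall B, S B -> infinite_set B) /\
  (forall A : set nat, infinite_set A ->
     exists2 B, S B & infinite_set (A `&` B) /\ infinite_set (A `\` B)).

Definition splitting_number : set (set nat) := min_card splitting_family.

Lemma splitting_numberP :
  splitting_family splitting_number /\
  forall S, splitting_family S -> splitting_number #<= S.
Proof.
apply: min_cardP; exists [set B | infinite_set B]; split=> // A Ainf.
have /infiniteP/pcard_leP[f] := Ainf.
have finj : injective f by move=> i j; apply: (inj (f := f)); rewrite inE.
have fA n : A (f n) by exact: funS.
have inf_range (g : nat -> nat) (B : set nat) :
    injective g -> range g `<=` B -> infinite_set B.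
  move=> ginj /subset_card_le gB; apply/infiniteP; apply: card_le_trans gB.
  have /card_esym : range g #= [set: nat] by apply: inj_card_eq => i j _ _ /ginj.
  by rewrite card_eq_le => /andP[].
have inj_even : injective (fun n => f n.*2).
  by move=> i j /finj/double_inj.
exists (range (fun n => f n.*2)); first exact: inf_range inj_even _.
split; first by apply: (inf_range _ _ inj_even) => _ [n _ <-]; split=> //; exists n.
apply: (inf_range (fun n => f n.*2.+1)) => [i j /finj[/double_inj]//|].
move=> _ [n _ <-]; split=> // -[m _ /finj /(congr1 odd)].
by rewrite /= !odd_double.
Qed.

(** A sequence indexed by an infinite set [A] of naturals is given by [A] and
    by a total family [K] whose values outside [A] are ignored. *)
Definition Li (X : topologicalType) (K : nat -> set X) (A : set nat) : set X :=
  [set x | forall U, nbhs x U ->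
     finite_set [set n | A n /\ ~ (U `&` K n !=set0)]].

Definition Ls (X : topologicalType) (K : nat -> set X) (A : set nat) : set X :=
  [set x | forall U, nbhs x U ->
     infinite_set [set n | A n /\ U `&` K n !=set0]].

Definition kuratowski_converges (X : topologicalType) (K : nat -> set X)
  (A : set nat) : Prop := Li K A = Ls K A.

Definition metrizable (R : realType) (X : topologicalType) : Prop :=
  exists d : X -> X -> R,
    [/\ forall x, d x x = 0,
        forall x y, d x y = 0 -> x = y,
        forall x y, d x y = d y x,
        forall x y z, d x z <= d x y + d y z &
        forall x, nbhs x =
          filter_from [set e | 0 < e] (fun e => [set y | d x y < e])].

(* Main.v *)
(** Let [D] be a dense set of size less than the splitting number.  For each
    radius [1/(n+1)] there are too few sets [{m | B(x, 1/(n+1)) meets K_m}],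
    [x] in [D], to split every infinite subset of a given infinite set.
    Refining successively for [n = 0, 1, ...] and taking a pseudo-intersection
    yields one infinite [A] split by none of them.  As these balls form a base,
    a point of [Ls K A] is in [Li K A].  Treating the radii one at a time avoids
    comparing [D * nat] with [D]. *)

Require Import Defs.
From mathcomp Require Import all_boot all_order all_algebra.
From mathcomp Require Import boolp classical_sets functions cardinality reals.
From mathcomp Require Import topology.

Import Order.TTheory GRing.Theory Num.Theory.
Local Open Scope classical_set_scope.

Definition unsplit (S A : set nat) : Prop :=
  finite_set (A `&` S) \/ finite_set (A `\` S).

(** This lets a pseudo-intersection inherit what each stage of a decreasing sequence achieved. *)
Lemma unsplit_almost_subset {S A B : set nat} :
  finite_set (B `\` A) -> unsplit S A -> unsplit S B.
Proof.
move=> finBA [fin|fin]; [left|right].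
- apply: (sub_finite_set (B := (A `&` S) `|` (B `\` A))).
    by move=> n [Bn Sn]; have [An|nAn] := pselect (A n); [left|right].
  by rewrite finite_setU.
- apply: (sub_finite_set (B := (A `\` S) `|` (B `\` A))).
    by move=> n [Bn Sn]; have [An|nAn] := pselect (A n); [left|right].
  by rewrite finite_setU.
Qed.

Lemma infinite_set_gt {A : set nat} (k : nat) :
  infinite_set A -> exists2 m, A m & (k < m)%N.
Proof.
move=> infA; apply: contrapT => noA; apply: infA.
apply: (sub_finite_set (B := `I_k.+1)) (finite_II _) => m Am /=.
by rewrite ltnNge; apply/negP => km; apply: noA; exists m.
Qed.

Lemma infinite_image {f : nat -> nat} {A : set nat} :
  injective f -> infinite_set A -> infinite_set (f @` A).
Proof.
move=> finj; apply: contra_not => finfA.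
apply: sub_finite_set (finite_preimage _ finfA); first by move=> n An; exists n.
by move=> i j _ _ /finj.
Qed.

(** Diagonal choice: a strictly increasing [h] with [h n] in [A n] has an infinite range, and only
    the values [h k] with [k < n] can lie outside [A n]. *)
Lemma pseudo_intersection {A : nat -> set nat} :
  (forall n, A n.+1 `<=` A n) -> (forall n, infinite_set (A n)) ->
  exists2 B, infinite_set B & forall n, finite_set (B `\` A n).
Proof.
move=> decA infA.
have /choice[next nextP] : forall nk : nat * nat,
    exists m, A nk.1 m /\ (nk.2 < m)%N.
  by move=> [n k]; have [m] := infinite_set_gt k (infA n); exists m.
(* The second argument of [next] is a strict lower bound; taking the previous value there makes [h]
   increase. *)
pose h := fix h n := if n is n'.+1 then next (n, h n') else next (0, 0).
have hA n : A n (h n) by case: n => [|n]; exact: (nextP (_, _)).1.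
have hlt : {homo h : i j / (i < j)%N}.
  by apply: homo_ltn => [|n]; [exact: ltn_trans|exact: (nextP (_, _)).2].
have hinj : injective h.
  by move=> i j hij; case: (ltngtP i j) => // /hlt; rewrite hij ltnn.
have subA i j : (i <= j)%N -> A j `<=` A i.
  by move/subnKC <-; elim: (j - i)%N => [|k IH];
    rewrite ?addn0 ?addnS // => x /decA/IH.
exists (range h); first exact: infinite_image hinj infinite_nat.
move=> n; apply: sub_finite_set (finite_image h (finite_II n)).
move=> _ [[k _ <-] nAk]; exists k => //=; rewrite ltnNge.
by apply/negP => nk; apply: nAk; exact: (subA n k nk _ (hA k)).
Qed.

(** An injection [f] of the naturals into [A] pulls the sets [S x] back to a family too small to be
    splitting; the image under [f] of an infinite set that this family fails to split is the
    required [B]. *)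
Lemma unsplit_refine {T : Type} {D : set T} (S : T -> set nat) {A : set nat} :
  ~ (splitting_number #<= D)%card -> infinite_set A ->
  exists B, [/\ infinite_set B, B `<=` A & forall x, D x -> unsplit (S x) B].
Proof.
move=> ltD /infiniteP/pcard_leP[f].
have finj : injective f by move=> i j; apply: (inj (f := f)); rewrite inE.
(* Members of a splitting family must be infinite, so finite preimages are dropped; they split
   nothing anyway. *)
pose D' := [set x | D x /\ infinite_set (f @^-1` S x)].
have [A' [infA' A'P]] : exists A', infinite_set A' /\
    forall x, D x -> unsplit (f @^-1` S x) A'.
  apply: contrapT => noA'; apply: ltD.
  apply: card_le_trans (subset_card_le (_ : D' `<=` D)); last by move=> x [].
  apply: card_le_trans (card_image_le (fun x => f @^-1` S x) D').
  apply: splitting_numberP.2; split=> [_ [x [_ ?] <-]//|A' infA'].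
  apply: contrapT => nosplit; apply: noA'; exists A'; split=> // x Dx.
  apply: contrapT => /not_orP[infI infD]; apply: nosplit.
  exists (f @^-1` S x) => //; exists x => //; split=> // finS; apply: infI.
  exact: sub_finite_set finS.
exists (f @` A'); split; first exact: infinite_image.
  by move=> _ [n _ <-]; exact: funS.
move=> x /A'P[] fin; [left|right];
  apply: sub_finite_set (finite_image f fin).
- by move=> _ [[n A'n <-] Sn]; exists n.
- by move=> _ [[n A'n <-] Sn]; exists n.
Qed.

Lemma unsplit_countable {T : Type} {D : set T} (S : nat -> T -> set nat) :
  ~ (splitting_number #<= D)%card ->
  exists2 A, infinite_set A & forall n x, D x -> unsplit (S n x) A.
Proof.
move=> ltD; have /choice[F FP] : forall nA : nat * set nat, exists B,
    infinite_set nA.2 ->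
    [/\ infinite_set B, B `<=` nA.2 & forall x, D x -> unsplit (S nA.1 x) B].
  move=> [n A]; have [infA|finA] := pselect (infinite_set A); last by exists A.
  by have [B BP] := unsplit_refine (S n) ltD infA; exists B.
(* The set [A 0] is already refined for [S 0], so stage [n] handles index [n] without a shift. *)
pose A := fix A n := if n is n'.+1 then F (n, A n') else F (0, setT).
have infA n : infinite_set (A n).
  elim: n => [|n IH]; first by case: (FP (0, setT)) => //; exact: infinite_nat.
  by case: (FP (n.+1, A n)).
have decA n : A n.+1 `<=` A n by case: (FP (n.+1, A n) (infA n)).
have AP n x : D x -> unsplit (S n x) (A n).
  case: n => [|n]; last by case: (FP (n.+1, A n) (infA n)) => _ _; exact.
  by case: (FP (0, setT) infinite_nat) => _ _; exact.
have [B infB BA] := pseudo_intersection decA infA.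
by exists B => // n x /(AP n); exact: unsplit_almost_subset.
Qed.

(** All but finitely many members of an infinite set are still infinitely many. *)
Lemma Li_subset_Ls {X : topologicalType} {K : nat -> set X} {A : set nat} :
  infinite_set A -> Li K A `<=` Ls K A.
Proof.
move=> infA x xLi U /xLi fin finU; apply: infA.
pose V := [set n | A n /\ U `&` K n !=set0].
apply: (sub_finite_set (B := V `|` [set n | A n /\ ~ (U `&` K n !=set0)])).
  by move=> n An; have [Un|nUn] := pselect (U `&` K n !=set0); [left|right].
by rewrite finite_setU.
Qed.

(** Balls of radius [1/(n+1)] centred in [D] suffice: if the radius is below [e/2], such a ball
    containing [x] stays within distance [e] of [x]. *)
Lemma metrizable_dense_base {R : realType} {X : topologicalType} {D : set X} :
  metrizable R X -> dense D ->
  exists b : nat -> X -> set X, forall (x : X) U, nbhs x U ->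
    exists n y, [/\ D y, nbhs x (b n y) & b n y `<=` U].
Proof.
move=> [d [_ _ dC dT nbhsd]] denseD.
exists (fun n y => [set z | d y z < n.+1%:R^-1]%R) => x U.
rewrite nbhsd => -[e /= e0 eU].
have [n ne] : exists n, (n.+1%:R^-1 < e / 2)%R.
  have e20 : (0 < e / 2)%R by rewrite divr_gt0.
  exists (Num.truncn (e / 2)^-1); rewrite invf_plt ?posrE //.
  by rewrite truncnS_gt.
pose V := [set z | d x z < n.+1%:R^-1]%R.
have xV : nbhs x V.
  by rewrite nbhsd; exists (n.+1%:R^-1)%R => //=; rewrite invr_gt0.
(* Density concerns nonempty open sets, so it is applied to the interior of [V], which contains
   [x]. *)
have [y [/interior_subset yV Dy]] :=
  denseD _ (ex_intro _ x (nbhs_singleton (nbhs_interior xV))) (open_interior V).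
exists n, y; split=> //.
  exists (n.+1%:R^-1 - d x y)%R; first by rewrite /= subr_gt0.
  move=> z /= xz; apply: le_lt_trans (dT y x z) _.
  by rewrite (dC y x) addrC -ltrBrDr.
move=> z /= yz; apply: eU => /=; apply: le_lt_trans (dT x y z) _.
rewrite (splitr e).
by apply: ltrD; apply: lt_trans ne.
Qed.

Theorem corollary2p2 (R : realType) (X : topologicalType)
    (metX : metrizable R X) (dX : card_lt (density X) splitting_number)
    (K : nat -> set X) :
  exists A : set nat, infinite_set A /\ kuratowski_converges K A.
Proof.
have [b bP] := metrizable_dense_base metX (densityP X).1.
have [A infA AP] := unsplit_countable
  (fun n x => [set m | b n x `&` K m !=set0]) dX.2.
exists A; split=> //; apply/seteqP; split; first exact: Li_subset_Ls.
move=> x xLs U /bP[n [y [Dy xb bU]]].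
(* As [x] is in [Ls K A], infinitely many [m] in [A] have [K m] meeting [b n y]; being unsplit, [A]
   then has only finitely many [m] for which [K m] misses it. *)
have [/(xLs _ xb)//|fin] := AP n y Dy.
apply: sub_finite_set fin => m [Am nUm]; split=> // -[z [bz Kz]].
by apply: nUm; exists z; split=> //; exact: bU.
Qed.
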